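(* Let $K$ be a field, $Q$ a finite quiver, $I$ an admissible ideal of $KQ$ and $A=KQ/I$. Let $w$ be a string, $M(w)$ the corresponding string module over $A$, and $P$ a perfect matching of the snake graph $\mathcal G(w)$. Then $P\ominus P_{min}$ gives rise to a canonical embedding $\varphi: M(P)\hookrightarrow M(w)$ (that is, the canonical inclusion of the module $M(P)$ determined by the tiles enclosed by $P\ominus P_{min}$ identifies $M(P)$ with a canonical submodule of $M(w)$), and $h(P\ominus P_{min})$ is the dimension vector of the submodule $M(P)$ of $M(w)$.
   Context: **Strings and string modules.** For an arrow $a$ of $Q$, $s(a)$ is its start and $t(a)$ its end; its formal inverse $a^{-1}$ satisfies $s(a^{-1})=t(a)$, $t(a^{-1})=s(a)$. A string is a word $w=a_1\cdots a_n$ in which each $a_i$ is an arrow or the inverse of an arrow, $s(a_{i+1})=t(a_i)$, $a_{i+1}\neq a_i^{-1}$ for all $i$, and no subword of $w$ or of its inverse lies in $I$; trivial strings (single vertices, $n=0$) are allowed. Its vertices are $v_1,\dots,v_{n+1}$, so $w=v_1a_1v_2\cdots a_nv_{n+1}$. The string module $M(w)$ over $A$ has basis $e_1,\dots,e_{n+1}$, with $e_i$ placed at vertex $v_i$; if $a_i$ is an arrow it sends $e_i\mapsto e_{i+1}$; if $a_i$ is the inverse of an arrow $b$, then $b$ sends $e_{i+1}\mapsto e_i$; all other actions of arrows on basis vectors are zero. A canonical submodule of $M(w)$ is a submodule spanned by a subset of the basis $\{e_i\}$, with the embedding induced by the identity on the non-zero components. **Snake graphs.** A tile is a unit square in the plane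 with sides parallel to the axes, viewed as a graph with 4 vertices and 4 edges. A snake graph is obtained from tiles $T_1,\dots,T_{n+1}$ by gluing, for each $i$, $T_{i+1}$ to $T_i$ along the right or the top edge of $T_i$. Three consecutive tiles form a straight piece if both gluings are to the right or both on top, and a zigzag otherwise. The snake graph $\mathcal G(w)$ of $w=a_1\cdots a_n$ has tiles $T_1,\dots,T_{n+1}$, with $T_i$ carrying the face weight $v_i$; $T_2$ is to the right of $T_1$ if $a_1$ is an arrow (direct) and on top of $T_1$ if $a_1$ is an inverse arrow; and for $2\le i\le n$ the tiles $T_{i-1},T_i,T_{i+1}$ form a zigzag if $a_{i-1},a_i$ are both direct or both inverse, and a straight piece otherwise. **Perfect matchings.** A perfect matching of a graph is a set of edges such that every vertex is incident to exactly one of them. A boundary edge of $\mathcal G(w)$ is an edge belonging to only one tile. The minimal perfect matching $P_{min}$ of $\mathcal G(w)$ is the perfect matching consisting of boundary edges only, such that whenever $v_i$ is a sink of $w$ (all letters of $w$ adjacent to $v_i$ point towards $v_i$, endpoints of $w$ included) the tile $T_i$ has two boundary edges in $P_{min}$. (If there is only one tile, $P_{min}$ is a fixed choice of one of the two perfect matchings.) The symmetric difference is $P\ominus P_{min}=(P\cup P_{min})\setminus(P\cap P_{min})$. It encloses a set of tiles of $\mathcal G(w)$; the union of these tiles is a union $\bigcup_j\mathcal H_j$ of snake subgraphs, where each $\mathcal H_j$ consists of a maximal sequence of consecutive enclosed tiles. **The module $M(P)$ and the function $h$.** For each $j$, let $w_j$ be the substring of $w$ on the vertices corresponding to the tiles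 of $\mathcal H_j$ (with the letters of $w$ between them). Set $M(P)=\bigoplus_jM(w_j)$, with $M(w_j)$ mapped to $M(w)$ by sending its standard basis to the basis vectors $e_i$ of $M(w)$ with $T_i$ a tile of $\mathcal H_j$. The face function $h$ sends a set of tiles to the vector whose entry at a vertex $v$ of $Q$ is the number of tiles in the set of face weight $v$; $h(P\ominus P_{min})$ means $h$ applied to the tiles enclosed by $P\ominus P_{min}$. *)

(* Defs.v *)
From HB Require Import structures.
From mathcomp Require Import all_boot all_algebra finmap.
From mathcomp.multinomials Require Import monalg.

Set Implicit Arguments.
Unset Strict Implicit.
Unset Printing Implicit Defensive.

Import GRing.Theory.

Local Open Scope fset_scope.
Local Open Scope ring_scope.

Record quiver := Quiver {
  Q0 : finType;
  Q1 : finType;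
  src : Q1 -> Q0;
  tgt : Q1 -> Q0 }.

Section Paths.
Variable Q : quiver.

Fixpoint composable (v : Q0 Q) (s : seq (Q1 Q)) : bool :=
  if s is a :: s' then (src a == v) && composable (tgt a) s' else true.

Definition path_end (v : Q0 Q) (s : seq (Q1 Q)) : Q0 Q := last v (map (@tgt Q) s).

(* The start vertex is part of the data, so that the trivial paths at different
   vertices are different. *)
Record qpath := QPath {
  qpath_val : Q0 Q * seq (Q1 Q);
  _ : composable qpath_val.1 qpath_val.2 }.

HB.instance Definition _ := [isSub for qpath_val].
HB.instance Definition _ := [Choice of qpath by <:].

Definition start (p : qpath) : Q0 Q := (val p).1.
Definition arrows (p : qpath) : seq (Q1 Q) := (val p).2.
Definition plen (p : qpath) : nat := size (arrows p).
Definition pend (p : qpath) : Q0 Q := path_end (start p) (arrows p).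

(* The [i]-th vertex, counted from 0, for [i <= plen p]. *)
Definition vertex (p : qpath) (i : nat) : Q0 Q :=
  nth (start p) (start p :: map (@tgt Q) (arrows p)) i.

Definition qpath_triv (v : Q0 Q) : qpath := @QPath (v, [::]) isT.

Lemma composable_cat v s t :
  composable v (s ++ t) = composable v s && composable (path_end v s) t.
Proof. by elim: s v => //= a s IH v; rewrite IH andbA. Qed.

Lemma composable_arrows (p : qpath) : composable (start p) (arrows p).
Proof. by case: p. Qed.

Lemma pcat_subproof (p q : qpath) : pend p = start q ->
  composable (start p) (arrows p ++ arrows q).
Proof.
by move=> e; rewrite composable_cat composable_arrows -/(pend p) e composable_arrows.
Qed.

Definition pcat (p q : qpath) : option qpath :=
  if pend p =P start q is ReflectT e
  then Some (@QPath (start p, arrows p ++ arrows q) (pcat_subproof e)) else None.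

Variant pcat_spec (p q : qpath) : option qpath -> Type :=
| PcatSome r of pend p = start q & val r = (start p, arrows p ++ arrows q)
    & pend r = pend q : pcat_spec p q (Some r)
| PcatNone of pend p <> start q : pcat_spec p q None.

Lemma pcatP (p q : qpath) : pcat_spec p q (pcat p q).
Proof.
rewrite /pcat; case: eqP => [e|]; last by constructor.
constructor=> //; rewrite {1}/pend /path_end [arrows _]/= map_cat last_cat.
exact: (congr1 (fun u => last u _) e).
Qed.

Lemma composable_sub v s i m : composable v s ->
  composable (nth v (v :: map (@tgt Q) s) i) (take m (drop i s)).
Proof.
elim: s v i m => [|a s IH] v [|i] m //= /andP[/eqP <- h].
- case: m => //= m; rewrite eqxx /=.
  by have := IH _ 0%N m h; rewrite drop0.
- by have [hi|hi] := ltnP i (size s).+1;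
  [rewrite (set_nth_default (tgt a)) /= ?size_map //; exact: (IH (tgt a))
  |rewrite drop_oversize // ltnW].
Qed.

Lemma vertex_arrow (p : qpath) i a : onth (arrows p) i = Some a ->
  vertex p i = src a /\ vertex p i.+1 = tgt a.
Proof.
rewrite /vertex; move: (composable_arrows p).
move: (start p) (arrows p) => v s; elim: s v i => [|b s IH] v [|i] //=.
  by case/andP=> /eqP <- _ [<-].
case/andP=> _ hs ha; have hi : (i < size s)%N by rewrite -onthTE ha.
case: (IH _ _ hs ha) => <- <-; split; apply: set_nth_default.
  by rewrite /= size_map ltnS ltnW.
by rewrite size_map.
Qed.

(* The part between the [i]-th and the [k]-th vertex, for [i <= k <= plen p]. *)
Definition subpath (p : qpath) (i k : nat) : qpath :=
  @QPath (vertex p i, take (k - i) (drop i (arrows p)))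
    (composable_sub i (k - i) (composable_arrows p)).

End Paths.

(* The letters are the arrows of [Q] ([inl]) and their formal inverses ([inr]);
   a word is a path in the quiver of all letters. *)
Definition double (Q : quiver) : quiver :=
  @Quiver (Q0 Q) (Q1 Q + Q1 Q)%type
    (fun l => match l with inl a => src a | inr a => tgt a end)
    (fun l => match l with inl a => tgt a | inr a => src a end).

Notation word Q := (qpath (double Q)).

Definition path_algebra (K : fieldType) (Q : quiver) : Type :=
  {malg K[qpath Q]}.

Section LinearExtension.
Variables (K : fieldType) (Q : quiver) (V : lmodType K).
Implicit Types (f g : qpath Q -> V) (x y : {malg K[qpath Q]}).

Definition lext f x : V := \sum_(p <- msupp x) x@_p *: f p.

Lemma lextEw (d : {fset qpath Q}) f x : msupp x `<=` d ->
  lext f x = \sum_(p <- d) x@_p *: f p.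
Proof.
move=> le; rewrite /lext (big_fset_incl _ le) // => p _ /mcoeff_outdom ->.
by rewrite scale0r.
Qed.

Lemma lextD f x y : lext f (x + y) = lext f x + lext f y.
Proof.
pose d := msupp x `|` msupp y.
rewrite (lextEw (d := d)) ?msuppD_le // (lextEw (d := d)) ?fsubsetUl //.
rewrite [lext f y](lextEw (d := d)) ?fsubsetUr // -big_split /=.
by apply: eq_bigr => p _; rewrite mcoeffD scalerDl.
Qed.

Lemma lextZ f c x : lext f (c *: x) = c *: lext f x.
Proof.
rewrite (lextEw (d := msupp x)) ?msuppZ_le // scaler_sumr.
by apply: eq_bigr => p _; rewrite mcoeffZ scalerA.
Qed.

Lemma lext0 f : lext f 0 = 0.
Proof. by rewrite -(scale0r 0) lextZ scale0r. Qed.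

Lemma lextU f p : lext f << p >> = f p.
Proof.
rewrite (lextEw (d := [fset p])) ?msuppU_le // big_seq_fset1.
by rewrite mcoeffUU scale1r.
Qed.

Lemma lext_sum (J : Type) (r : seq J) f (F : J -> {malg K[qpath Q]}) :
  lext f (\sum_(j <- r) F j) = \sum_(j <- r) lext f (F j).
Proof.
by elim/big_rec2: _ => [|j y x _ <-]; rewrite ?lext0 ?lextD.
Qed.

Lemma eq_lext f g x : f =1 g -> lext f x = lext g x.
Proof. by move=> e; apply: eq_bigr => p _; rewrite e. Qed.

Lemma lext_funD f g x : lext (fun p => f p + g p) x = lext f x + lext g x.
Proof. by rewrite -big_split; apply: eq_bigr => p _; rewrite scalerDr. Qed.

End LinearExtension.

Lemma lext_comp (K : fieldType) (Q : quiver) (V W : lmodType K)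
    (h : V -> W) (f : qpath Q -> V) x :
  (forall u v, h (u + v) = h u + h v) -> (forall c u, h (c *: u) = c *: h u) ->
  h (lext f x) = lext (fun p => h (f p)) x.
Proof.
move=> hD hZ; rewrite /lext; have h0 : h 0 = 0 by rewrite -(scale0r 0) hZ scale0r.
by elim/big_rec2: _ => // p y z _ <-; rewrite hD hZ.
Qed.

Section PathAlgebra.
Variables (K : fieldType) (Q : quiver).
Local Notation KQ := {malg K[qpath Q]}.
Implicit Types (p q r : qpath Q) (x y z : KQ).

Definition pmul p q : KQ := if pcat p q is Some r then << r >> else 0.

Definition kq_mul x y : KQ := lext (fun p => lext (pmul p) y) x.

Definition kq_one : KQ := \sum_(v : Q0 Q) << qpath_triv v >>.

Lemma lext_id x : lext (fun p => << p >> : KQ) x = x.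
Proof.
rewrite [RHS]monalgE; apply: eq_bigr => p _; apply/malgP => k.
by rewrite mcoeffZ !mcoeffU mulrnAr mulr1.
Qed.

Lemma kq_mulDl : left_distributive kq_mul +%R.
Proof. by move=> x y z; exact: lextD. Qed.

Lemma kq_mulDr : right_distributive kq_mul +%R.
Proof.
by move=> x y z; rewrite /kq_mul -lext_funD; apply: eq_lext => p; exact: lextD.
Qed.

Lemma kq_mulZl c x y : kq_mul (c *: x) y = c *: kq_mul x y.
Proof. exact: lextZ. Qed.

Lemma kq_mulZr c x y : kq_mul x (c *: y) = c *: kq_mul x y.
Proof.
rewrite /kq_mul (lext_comp (h := *:%R c)) => [|u v|d u]; last 2 first.
- exact: scalerDr.
- by rewrite !scalerA mulrC.
by apply: eq_lext => p; exact: lextZ.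
Qed.

Lemma kq_mul0l x : kq_mul 0 x = 0.
Proof. exact: lext0. Qed.

Lemma kq_mul0r x : kq_mul x 0 = 0.
Proof. by apply: (addIr (kq_mul x 0)); rewrite -kq_mulDr !add0r. Qed.

Lemma kq_mulU p q : kq_mul << p >> << q >> = pmul p q.
Proof. by rewrite /kq_mul !lextU. Qed.

Lemma pmulA p q r :
  kq_mul (pmul p q) << r >> = kq_mul << p >> (pmul q r).
Proof.
rewrite [pmul p q]/pmul [pmul q r]/pmul; case: pcatP => [u e hu pu|ne]; case: pcatP => [v e' hv pv|ne'].
- rewrite !kq_mulU /pmul; case: pcatP => [s es hs _|[]]; last by rewrite pu.
  case: pcatP => [t et ht _|[]]; last by rewrite e /start hv.
  congr << _ >>; apply: val_inj; rewrite hs ht /start /arrows hu hv /=.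
  by rewrite catA.
- rewrite kq_mulU /pmul; case: pcatP => [s es|_]; last by rewrite kq_mul0r.
  by case: ne'; rewrite -es pu.
- rewrite kq_mulU /pmul; case: pcatP => [s es|_]; last by rewrite kq_mul0l.
  by case: ne; rewrite es /start hv.
- by rewrite kq_mul0l kq_mul0r.
Qed.

Lemma kq_linear_ext (V : lmodType K) (f g : KQ -> V) :
  linear f -> linear g -> (forall p, f << p >> = g << p >>) -> f =1 g.
Proof.
have key (h : KQ -> V) : linear h -> forall x, h x = lext (fun p => h << p >>) x.
  move=> hl x; have hD u v : h (u + v) = h u + h v by have := hl 1 u v; rewrite !scale1r.
  have h0 : h 0 = 0 by apply: (addIr (h 0)); rewrite -hD !add0r.
  rewrite -{1}(lext_id x) (lext_comp _ _ hD) // => c u.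
  by have := hl c u 0; rewrite h0 !addr0.
by move=> fl gl fg x; rewrite (key f fl) (key g gl); apply: eq_lext.
Qed.

Lemma kq_mul_linearl y : linear (kq_mul^~ y).
Proof. by move=> c u v; rewrite kq_mulDl kq_mulZl. Qed.

Lemma kq_mul_linearr x : linear (kq_mul x).
Proof. by move=> c u v; rewrite kq_mulDr kq_mulZr. Qed.

Lemma kq_mulA : associative kq_mul.
Proof.
move=> x y z.
have linC (f g : KQ -> KQ) : linear f -> linear g -> linear (fun u : KQ => f (g u) : KQ).
  by move=> fl gl c u v; rewrite gl fl.
pose ll := kq_mul_linearl; pose lr := kq_mul_linearr.
refine (kq_linear_ext (ll (kq_mul y z)) (linC _ _ (ll z) (ll y)) _ x) => p.
refine (kq_linear_ext (linC _ _ (lr << p >>) (ll z))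
  (linC _ _ (ll z) (lr << p >>)) _ y) => q /=.
refine (kq_linear_ext (linC _ _ (lr << p >>) (lr << q >>))
  (lr (kq_mul << p >> << q >>)) _ z) => r.
transitivity (kq_mul << p >> (pmul q r)); first by congr (kq_mul _ _); exact: kq_mulU.
rewrite -pmulA; congr (kq_mul _ _).
exact/esym/kq_mulU.
Qed.

Lemma pcat1p v p : pcat (qpath_triv v) p = if v == start p then Some p else None.
Proof.
case: pcatP => [r e hr _|ne]; last by case: eqP.
have ev : v = start p := e; rewrite ev eqxx; congr Some.
by apply: val_inj; rewrite hr ev [RHS]surjective_pairing.
Qed.

Lemma pcatp1 v p : pcat p (qpath_triv v) = if v == pend p then Some p else None.
Proof.
case: pcatP => [r e hr _|ne]; last by case: eqP => // e; case: ne.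
have ev : pend p = v := e; rewrite ev eqxx; congr Some.
by apply: val_inj; rewrite hr cats0 [RHS]surjective_pairing.
Qed.

Lemma kq_mul1 : left_id kq_one kq_mul.
Proof.
move=> x; rewrite -[RHS]lext_id /kq_mul /kq_one lext_sum.
under eq_bigr do rewrite lextU.
rewrite /lext exchange_big /=; apply: eq_bigr => p _.
rewrite -scaler_sumr; congr (_ *: _).
rewrite (bigD1 (start p)) //= big1 => [|v /negPf nv].
  by rewrite addr0 /pmul pcat1p eqxx.
by rewrite /pmul pcat1p nv.
Qed.

Lemma kq_mul1r : right_id kq_one kq_mul.
Proof.
move=> x; rewrite -[RHS]lext_id /kq_mul; apply: eq_lext => p.
rewrite /kq_one lext_sum; under eq_bigr do rewrite lextU.
rewrite (bigD1 (pend p)) //= big1 => [|v /negPf nv].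
  by rewrite addr0 /pmul pcatp1 eqxx.
by rewrite /pmul pcatp1 nv.
Qed.

HB.instance Definition _ :=
  GRing.Lmodule.copy (path_algebra K Q) {malg K[qpath Q]}.

HB.instance Definition _ := GRing.Zmodule_isPzRing.Build (path_algebra K Q)
  kq_mulA kq_mul1 kq_mul1r kq_mulDl kq_mulDr.

(* The scalars act compatibly ([kq_mulZl], [kq_mulZr]); there is no [algType]
   instance because [path_algebra K Q] is the zero ring if [Q] has no vertex. *)

End PathAlgebra.

Section Ideals.
Variables (K : fieldType) (Q : quiver).
Local Notation KQ := (path_algebra K Q).
Implicit Types (S I J : KQ -> Prop).

Definition qbasis (p : qpath Q) : KQ := << p >>.

Definition two_sided_ideal I : Prop :=
  [/\ I 0, forall x y, I x -> I y -> I (x + y),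
      forall x y, I y -> I (x * y) & forall x y, I x -> I (x * y)].

Definition ideal_gen S : KQ -> Prop :=
  fun x => forall J, two_sided_ideal J -> (forall y, S y -> J y) -> J x.

Definition ideal_mul I J : KQ -> Prop :=
  ideal_gen (fun z => exists x y, [/\ I x, J y & z = x * y]).

Definition ideal_pow I (m : nat) : KQ -> Prop :=
  iter m (fun J => ideal_mul J I) (fun=> True).

Definition arrow_ideal : KQ -> Prop :=
  ideal_gen (fun x => exists2 p, plen p = 1%N & x = qbasis p).

Definition admissible I : Prop :=
  [/\ two_sided_ideal I,
      exists2 m, (2 <= m)%N & forall x, ideal_pow arrow_ideal m x -> I x
    & forall x, I x -> ideal_pow arrow_ideal 2 x].

End Ideals.

(* A right [KQ]-module on the space of row vectors 'rV_n: the path of length 0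
   at [v] acts by [X |-> X *m idem v], the arrow [a] by [X |-> X *m act a].
   Right modules are what matches words read from left to right with
   [s(a_{i+1}) = t(a_i)]. *)
Record kqmod (K : fieldType) (Q : quiver) (n : nat) := KQMod {
  idem : Q0 Q -> 'M[K]_n;
  act : Q1 Q -> 'M[K]_n;
  idemM : forall u v, idem u *m idem v = if u == v then idem u else 0;
  sum_idem : \sum_v idem v = 1%:M;
  idem_act : forall a, idem (src a) *m act a = act a;
  act_idem : forall a, act a *m idem (tgt a) = act a }.

Section Modules.
Variables (K : fieldType) (Q : quiver).
Implicit Types (I : path_algebra K Q -> Prop).

Definition path_act n (M : kqmod K Q n) (p : qpath Q) : 'M[K]_n :=
  foldl (fun X a => X *m act M a) (idem M (start p)) (arrows p).

Definition kq_act n (M : kqmod K Q n) (x : path_algebra K Q) : 'M[K]_n :=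
  lext (path_act M) x.

Lemma foldl_act n (M : kqmod K Q n) (X Y : 'M[K]_n) s :
  foldl (fun Z a => Z *m act M a) (X *m Y) s
    = X *m foldl (fun Z a => Z *m act M a) Y s.
Proof. by elim: s Y => //= a s IH Y; rewrite -mulmxA IH. Qed.

Lemma path_act_end n (M : kqmod K Q n) (p : qpath Q) :
  path_act M p *m idem M (pend p) = path_act M p.
Proof.
rewrite /path_act /pend /path_end; elim/last_ind: (arrows p) => [|s a _] /=.
  by rewrite idemM eqxx.
by rewrite map_rcons last_rcons foldl_rcons -mulmxA act_idem.
Qed.

Lemma path_act_cat n (M : kqmod K Q n) (p q : qpath Q) :
  path_act M p *m path_act M q
    = if pcat p q is Some r then path_act M r else 0.
Proof.
have st (t : qpath Q) : idem M (start t) *m path_act M t = path_act M t.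
  by rewrite -foldl_act idemM eqxx.
case: pcatP => [r e hr _|/eqP/negPf ne].
  rewrite [path_act M q]/path_act -foldl_act -e path_act_end.
  by rewrite /path_act -foldl_cat /start /arrows hr.
by rewrite -(path_act_end M p) -(st q) -mulmxA (mulmxA (idem M _)) idemM ne mul0mx mulmx0.
Qed.

(* [kq_act M] is a homomorphism of K-algebras: [M] is a right module over the
   ring [path_algebra K Q]. *)
Lemma kq_act_linear n (M : kqmod K Q n) (c : K) (x y : path_algebra K Q) :
  kq_act M (c *: x + y) = c *: kq_act M x + kq_act M y.
Proof. by rewrite /kq_act lextD lextZ. Qed.

Lemma kq_act1 n (M : kqmod K Q n) : kq_act M 1 = 1%:M.
Proof.
rewrite -(sum_idem M) /kq_act [1]/(kq_one K Q) /kq_one lext_sum.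
by apply: eq_bigr => v _; rewrite lextU.
Qed.

Lemma kq_actM n (M : kqmod K Q n) (x y : path_algebra K Q) :
  kq_act M (x * y) = kq_act M x *m kq_act M y.
Proof.
rewrite [x * y]/(kq_mul x y) /kq_act /kq_mul.
rewrite (lext_comp (h := lext (path_act M))); last 2 first.
- exact: lextD.
- exact: lextZ.
rewrite (lext_comp (h := mulmx^~ (lext (path_act M) y))); last 2 first.
- by move=> u v; rewrite mulmxDl.
- by move=> c u; rewrite scalemxAl.
apply: eq_lext => p.
rewrite (lext_comp (h := lext (path_act M))); last 2 first.
- exact: lextD.
- exact: lextZ.
rewrite (lext_comp (h := mulmx (path_act M p))); last 2 first.
- by move=> u v; rewrite mulmxDr.
- by move=> c u; rewrite scalemxAr.
apply: eq_lext => q; rewrite path_act_cat /pmul.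
by case: (pcat p q) => [r|]; rewrite ?lextU ?lext0.
Qed.

(* The A-modules, A = KQ/I, are the KQ-modules annihilated by [I]; their
   submodules and homomorphisms over A and over KQ are the same. *)
Definition is_Amod I n (M : kqmod K Q n) : Prop :=
  forall x, I x -> kq_act M x = 0.

Definition is_hom m n (M : kqmod K Q m) (N : kqmod K Q n) (F : 'M[K]_(m, n)) :
    Prop :=
  (forall v, idem M v *m F = F *m idem N v) /\
  (forall a, act M a *m F = F *m act N a).

Definition is_embedding m n (M : kqmod K Q m) (N : kqmod K Q n)
    (F : 'M[K]_(m, n)) : Prop :=
  is_hom M N F /\ row_free F.

(* The submodule is given as the row space of a matrix. *)
Definition is_submod m n (M : kqmod K Q n) (U : 'M[K]_(m, n)) : Prop :=
  (forall v, stablemx U (idem M v)) /\ (forall a, stablemx U (act M a)).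

Definition dimvec n (M : kqmod K Q n) (v : Q0 Q) : nat := \rank (idem M v).

Section DirectSum.
Variables (r : nat) (d : 'I_r -> nat) (M : forall j, kqmod K Q (d j)).

Lemma mul_mxdiag (B C : forall j, 'M[K]_(d j)) :
  (\mxdiag_j B j) *m (\mxdiag_j C j) = \mxdiag_j (B j *m C j).
Proof.
rewrite [X in _ *m X]/mxdiag mul_mxdiag_mxblock; apply: eq_mxblock => i j.
case: eqP => [e|_]; last by rewrite mulmx0.
by case: _ / e; rewrite !conform_mx_id.
Qed.

Definition dsum : kqmod K Q (\sum_j d j).
Proof.
apply: (@KQMod K Q _ (fun v => \mxdiag_j idem (M j) v)
                     (fun a => \mxdiag_j act (M j) a)).
- move=> u v; rewrite mul_mxdiag.
  under eq_mxdiag do rewrite idemM.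
  by case: eqP => // _; rewrite mxdiag0.
- rewrite -mxdiag_sum; under eq_mxdiag do rewrite sum_idem.
  by rewrite mxdiagZ.
- by move=> a; rewrite mul_mxdiag; under eq_mxdiag do rewrite idem_act.
- by move=> a; rewrite mul_mxdiag; under eq_mxdiag do rewrite act_idem.
Defined.

End DirectSum.
End Modules.

Section Strings.
Variables (K : fieldType) (Q : quiver).
Implicit Types (w : word Q).

Definition letter_inv (l : Q1 Q + Q1 Q) : Q1 Q + Q1 Q :=
  match l with inl a => inr a | inr a => inl a end.

Definition word_inv_letters w : seq (Q1 Q + Q1 Q) :=
  rev (map letter_inv (arrows w)).

Definition direct_letters (p : qpath Q) : seq (Q1 Q + Q1 Q) :=
  map inl (arrows p).

(* Only subwords of positive length are tested: trivial paths never lie in an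
   admissible ideal. *)
Definition is_string (I : path_algebra K Q -> Prop) w : Prop :=
  sorted (fun l l' => l' != letter_inv l) (arrows w) /\
  (forall p : qpath Q, (0 < plen p)%N ->
     infix (direct_letters p) (arrows w)
       || infix (direct_letters p) (word_inv_letters w) ->
     ~ I (qbasis K p)).

(* [act a] sends e_i to e_j. Indices are counted from 0: the i-th letter of the
   list joins e_i and e_{i+1}. *)
Definition moves w (a : Q1 Q) (i j : nat) : bool :=
  (j == i.+1) && (onth (arrows w) i == Some (inl a))
  || (i == j.+1) && (onth (arrows w) j == Some (inr a)).

Definition string_idem w (v : Q0 Q) : 'M[K]_((plen w).+1) :=
  \matrix_(i, j) ((i == j) && (vertex w i == v))%:R.

Definition string_act w (a : Q1 Q) : 'M[K]_((plen w).+1) :=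
  \matrix_(i, j) (moves w a i j)%:R.

Lemma moves_vertex w a i j : moves w a i j -> vertex w i = src a /\ vertex w j = tgt a.
Proof.
case/orP=> /andP[/eqP-> /eqP h]; have [h1 h2] := vertex_arrow h.
  exact: (conj h1 h2).
exact: (conj h2 h1).
Qed.

Lemma string_idem_mul w v n (X : 'M[K]_((plen w).+1, n)) i j :
  (string_idem w v *m X) i j = if vertex w i == v then X i j else 0.
Proof.
rewrite mxE (bigD1 i) //= big1 => [|k /negPf nk].
  by rewrite mxE eqxx addr0; case: eqP; rewrite ?mul1r ?mul0r.
by rewrite mxE eq_sym nk mul0r.
Qed.

Lemma string_mul_idem w v n (X : 'M[K]_(n, (plen w).+1)) i j :
  (X *m string_idem w v) i j = if vertex w j == v then X i j else 0.
Proof.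
rewrite mxE (bigD1 j) //= big1 => [|k /negPf nk].
  by rewrite mxE eqxx addr0; case: eqP; rewrite ?mulr1 ?mulr0.
by rewrite mxE nk mulr0.
Qed.

Definition string_mod w : kqmod K Q (plen w).+1.
Proof.
apply: (@KQMod K Q _ (string_idem w) (string_act w)).
- move=> u v; apply/matrixP=> i j; rewrite string_idem_mul.
  case: (eqVneq u v) => [->|uv]; rewrite !mxE; first by case: eqP; rewrite ?andbF.
  case: eqP => // ->; rewrite (negPf uv) andbF.
  by [].
- apply/matrixP=> i j; rewrite summxE (bigD1 (vertex w i)) //= big1 => [|v nv].
    by rewrite !mxE eqxx andbT addr0.
  by rewrite mxE [_ == v]eq_sym (negPf nv) andbF.
- move=> a; apply/matrixP=> i j; rewrite string_idem_mul !mxE.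
  by case: eqP => // ne; case: (boolP (moves _ _ _ _)) => // /moves_vertex [].
- move=> a; apply/matrixP=> i j; rewrite string_mul_idem !mxE.
  by case: eqP => // ne; case: (boolP (moves _ _ _ _)) => // /moves_vertex [].
Defined.

Lemma is_string_subpath (I : path_algebra K Q -> Prop) w i k :
  is_string I w -> is_string I (subpath w i k).
Proof.
have sub : infix (arrows (subpath w i k)) (arrows w).
  apply/infixP; exists (take i (arrows w)), (drop (k - i) (drop i (arrows w))).
  by rewrite /arrows /= !cat_take_drop.
case=> red avoid; split; last first.
  move=> p hp h; apply: avoid => //; case/orP: h => h; apply/orP; [left|right].
    exact: infix_trans h sub.
  apply: (infix_trans h); rewrite /word_inv_letters -!map_rev.
  case/infixP: sub => s1 [s2 ->]; rewrite !rev_cat !map_cat.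
  by apply/infixP; do 2 eexists; rewrite -catA.
exact/take_sorted/drop_sorted.
Qed.

End Strings.

Definition point := (nat * nat)%type.

(* [(x, y, true)] is the horizontal edge from [(x, y)] to [(x+1, y)],
   [(x, y, false)] the vertical edge from [(x, y)] to [(x, y+1)]. *)
Definition edge := (nat * nat * bool)%type.

Definition edge_ends (e : edge) : seq point :=
  let: (x, y, h) := e in [:: (x, y); if h then (x.+1, y) else (x, y.+1)].

(* A unit square is named by its lower left corner. *)
Definition square_edges (c : point) : seq edge :=
  let: (x, y) := c in
  [:: (x, y, true); (x, y.+1, true); (x, y, false); (x.+1, y, false)].

Definition square_vertices (c : point) : seq point :=
  let: (x, y) := c in [:: (x, y); (x.+1, y); (x, y.+1); (x.+1, y.+1)].

Definition is_direct (A B : Type) (l : A + B) : bool :=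
  if l is inl _ then true else false.

(* [true]: glued along the right edge; [false]: glued along the top edge.
   [g] is the previous gluing and [l] the letter before [s]. *)
Fixpoint gluings_from (A B : Type) (g : bool) (l : A + B) (s : seq (A + B)) :
    seq bool :=
  if s is l' :: s' then
    let g' := if is_direct l == is_direct l' then ~~ g else g in
    g' :: gluings_from g' l' s'
  else [::].

Definition gluings (A B : Type) (s : seq (A + B)) : seq bool :=
  if s is l :: s' then is_direct l :: gluings_from (is_direct l) l s' else [::].

Section Snake.
Variables (Q : quiver) (w : word Q).

Local Notation tile_index := 'I_((plen w).+1).

(* The position in the plane of T_{i+1}; T_1 is put at (1, 1). Tiles glued this
   way share in the plane exactly the vertices and edges identified by the
   gluings. *)
Definition tile (i : nat) : point :=
  let g := take i (gluings (arrows w)) in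
  ((count id g).+1, (count negb g).+1).

Definition is_snake_edge (e : edge) : bool :=
  [exists i : tile_index, e \in square_edges (tile i)].

Definition is_snake_vertex (p : point) : bool :=
  [exists i : tile_index, p \in square_vertices (tile i)].

Definition is_boundary_edge (e : edge) : bool :=
  #|[set i : tile_index | e \in square_edges (tile i)]| == 1%N.

Definition perfect_matching (P : {fset edge}) : Prop :=
  (forall e, e \in P -> is_snake_edge e) /\
  (forall p, is_snake_vertex p -> exists! e, e \in P /\ p \in edge_ends e).

Definition is_sink (i : nat) : Prop :=
  ((0 < i)%N -> exists a, onth (arrows w) i.-1 = Some (inl a)) /\
  ((i < plen w)%N -> exists a, onth (arrows w) i = Some (inr a)).

(* If there is only one tile, this holds for both of its perfect matchings. *)
Definition minimal_matching (P : {fset edge}) : Prop :=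
  [/\ perfect_matching P,
      forall e, e \in P -> is_boundary_edge e
    & forall i : tile_index, is_sink i ->
        count (fun e => is_boundary_edge e && (e \in P)) (square_edges (tile i))
          = 2].

Definition symdiff (P P' : {fset edge}) : {fset edge} := (P `|` P') `\` (P `&` P').

(* The unit squares of a grid that contains the snake graph and, all around it,
   a frame of squares outside of it. *)
Definition cell := ('I_((plen w).+3) * 'I_((plen w).+3))%type.

Definition crossable (D : {fset edge}) (c c' : cell) : bool :=
  let: (x, y) := (c.1 : nat, c.2 : nat) in
  let: (x', y') := (c'.1 : nat, c'.2 : nat) in
  [|| [&& y' == y, x' == x.+1 & (x', y, false) \notin D],
      [&& y' == y, x == x'.+1 & (x, y, false) \notin D],
      [&& x' == x, y' == y.+1 & (x, y', true) \notin D]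
    | [&& x' == x, y == y'.+1 & (x, y, true) \notin D]].

(* A tile is enclosed by [D] if one cannot get from it to the outer cell
   (0, 0) without crossing [D], i.e. if it is not in the unbounded component
   of the complement of [D]. *)
Definition enclosed (D : {fset edge}) : {set tile_index} :=
  [set i : tile_index |
    ~~ connect (crossable D) (inord (tile i).1, inord (tile i).2) (ord0, ord0)].

Definition face (S : {set tile_index}) (v : Q0 Q) : nat :=
  #|[set i in S | vertex w i == v]|.

(* The pairs (i, k) such that T_{i+1}, ..., T_{k+1} is a maximal sequence of
   consecutive tiles in [S]. *)
Definition runs (S : {set tile_index}) : {set tile_index * tile_index} :=
  [set ik : tile_index * tile_index |
    [&& (ik.1 <= ik.2)%N,
        [forall l : tile_index, (ik.1 <= l <= ik.2)%N ==> (l \in S)],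
        [forall l : tile_index, (l.+1 == ik.1) ==> (l \notin S)]
      & [forall l : tile_index, (l == ik.2.+1 :> nat) ==> (l \notin S)]]].

Definition run_start (S : {set tile_index}) (j : 'I_#|runs S|) : tile_index :=
  (enum_val j).1.

Definition run_word (S : {set tile_index}) (j : 'I_#|runs S|) : word Q :=
  subpath w (enum_val j).1 (enum_val j).2.

Variable K : fieldType.

Definition run_mod (S : {set tile_index}) :=
  dsum (fun j : 'I_#|runs S| => string_mod K (run_word j)).

(* The l-th basis vector of [M(w_j)] goes to the basis vector of [M(w)] at the
   l-th tile of the j-th run. *)
Definition run_map (S : {set tile_index}) :
    'M[K]_(\sum_(j < #|runs S|) (plen (run_word j)).+1, (plen w).+1) :=
  \mxcol_(j < #|runs S|)
    \matrix_(l < (plen (run_word j)).+1, i < (plen w).+1)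
      (i == (run_start j + l)%N :> nat)%:R.

(* The span, as a row space, of the basis vectors e_i with [i] in [S]. *)
Definition basis_span (S : {set tile_index}) : 'M[K]_((plen w).+1) :=
  \matrix_(i, j) ((i == j) && (i \in S))%:R.

Definition is_canonical_submod m (U : 'M[K]_(m, (plen w).+1)) : Prop :=
  is_submod (string_mod K w) U /\ exists S, (U == basis_span S)%MS.

End Snake.

Arguments face {Q} w S v.
Arguments runs {Q} w S.
Arguments run_start {Q} w S j.
Arguments run_word {Q} w S j.
Arguments run_mod {Q} w K S.
Arguments run_map {Q} w K S.
Arguments basis_span {Q} w K S.
Arguments is_canonical_submod {Q} w {K m} U.

(* Main.v *)
(* Sign the edges by the parity of their ends and subtract from a perfect
   matching [P] the boundary matching which is minimal for [w]. The result is a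
   divergence free flow on the square lattice, hence the gradient of a height
   function on the unit squares. The height vanishes off the snake graph, is 0
   or 1 on the tiles, and is nondecreasing along the arrows of [w]; the height
   of [Pmin] is 0 because it is constant on the tiles and 0 at a sink. Hence
   [P] and [Pmin] enclose exactly the tiles of height 1 of [P], and these are
   closed under the action of the arrows (if [w] has no letter, there is no sink
   argument, but every set of tiles is closed). The rows of the map from [M(P)] to
   [M(w)] are then distinct basis vectors spanning a submodule. *)
Require Import Defs.
From mathcomp Require Import all_boot all_algebra finmap.
From mathcomp.multinomials Require Import monalg.
From mathcomp Require Import zify.

Import GRing.Theory.

Set Implicit Arguments.
Unset Strict Implicit.
Unset Printing Implicit Defensive.

Local Open Scope fset_scope.
Local Open Scope ring_scope.

(** * Positions of the tiles *)

Section Staircase.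
Variables (Q : quiver) (w : word Q).
Local Open Scope nat_scope.

Lemma size_gluings (A B : Type) (s : seq (A + B)) : size (gluings s) = size s.
Proof.
case: s => //= l s; congr _.+1.
by elim: s l (is_direct l) => //= l' s IH l1 g; rewrite IH.
Qed.

(** A gluing repeats the previous one exactly when the direction of the letters changes, so gluing
    xor direction alternates along the word; at index 0 it is false. *)
Lemma nth_gluings (A B : Type) (s : seq (A + B)) i l : onth s i = Some l ->
  nth false (gluings s) i = is_direct l (+) odd i.
Proof.
(* [b] is this xor at the letter [l0] before the list, hence the shift by one in [~~ odd i]. *)
have from : forall s i g l0 b, g = is_direct l0 (+) b -> onth s i = Some l ->
    nth false (gluings_from g l0 s) i = is_direct l (+) b (+) ~~ odd i.
  elim=> [|l' s' IH] [|j] g l0 b // -> /=.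
    by case=> ->; case: (is_direct l) (is_direct l0) b => [] [] [].
  move=> hj; rewrite (IH _ _ _ (~~ b)) //.
    by case: b; case: (is_direct l) (odd j) => [] [].
  by case: (is_direct l0) (is_direct l') b => [] [] [].
case: s i => [|l0 s] [|i] //= hi; first by case: hi => ->; rewrite addbF.
by rewrite (from _ _ _ _ false) ?addbF.
Qed.

Lemma tile0 : tile w 0 = (1, 1).
Proof. by rewrite /tile take0. Qed.

Lemma tileS i : i < plen w ->
  tile w i.+1 = if nth false (gluings (arrows w)) i
    then ((tile w i).1.+1, (tile w i).2) else ((tile w i).1, (tile w i).2.+1).
Proof.
move=> hi; rewrite /tile (take_nth false) ?size_gluings // -cats1 !count_cat.
by case: (nth _ _ _) => /=; rewrite !addn0 addn1.
Qed.

Local Opaque tile.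

Lemma tile_sum i : i <= plen w -> (tile w i).1 + (tile w i).2 = i.+2.
Proof.
elim: i => [|i IH] hi; first by rewrite tile0.
by rewrite tileS //; have := IH (ltnW hi); case: ifP => /= _; lia.
Qed.

Lemma tile_mono i j : i <= j <= plen w ->
  (tile w i).1 <= (tile w j).1 /\ (tile w i).2 <= (tile w j).2.
Proof.
case/andP; elim: j => [|j IH]; first by case: i.
rewrite leq_eqVlt => /predU1P[-> //|hij] hj.
have [h1 h2] := IH hij (ltnW hj); rewrite tileS //.
by case: ifP => /= _; split; lia.
Qed.

Definition is_tile (x y : nat) : bool :=
  [exists i : 'I_(plen w).+1, tile w i == (x, y)].

Lemma is_tileP x y :
  reflect (exists2 i, i <= plen w & tile w i = (x, y)) (is_tile x y).
Proof.
apply: (iffP existsP) => [[i /eqP e]|[i hi e]]; first by exists i; first exact: (ltn_ord i).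
by exists (Ordinal (hi : i < (plen w).+1)); apply/eqP.
Qed.

Lemma is_tile_tile i : i <= plen w -> is_tile (tile w i).1 (tile w i).2.
Proof. by move=> hi; apply/is_tileP; exists i; rewrite -1?surjective_pairing. Qed.

Lemma is_tile_bounds x y : is_tile x y ->
  0 < x <= (plen w).+1 /\ 0 < y <= (plen w).+1.
Proof.
case/is_tileP=> i hi e; have := tile_sum hi.
have [] := @tile_mono 0 i; rewrite ?hi // tile0 e /=; lia.
Qed.

Lemma is_tile0y y : is_tile 0 y = false.
Proof. by apply: negbTE; apply/negP => /is_tile_bounds[]. Qed.

Lemma is_tilex0 x : is_tile x 0 = false.
Proof. by apply: negbTE; apply/negP => /is_tile_bounds[]. Qed.

(** Both coordinates are monotone along the word: the snake is a staircase towards the upper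
    right. *)
Lemma is_tile_antidiag x y x' y' : x < x' -> y' < y ->
  is_tile x y -> is_tile x' y' -> False.
Proof.
move=> hx hy /is_tileP[i hi ei] /is_tileP[j hj ej].
case: (leqP i j) => hij.
  by have [] := @tile_mono i j; rewrite ?hij // ei ej /=; lia.
by have [] := @tile_mono j i; rewrite ?hi ?(ltnW hij) // ei ej /=; lia.
Qed.

(** A tile below and a tile to the left would form an antidiagonal pair. Hence from a cell off the
    snake there is a tile-free straight way to an axis. *)
Lemma out_col_or_row x y : ~~ is_tile x y ->
  (forall y', y' <= y -> is_tile x y' = false) \/
  (forall x', x' <= x -> is_tile x' y = false).
Proof.
move=> hxy.
have [/existsP[[y' hy'] /= t1]|/existsPn h1] := boolP [exists y' : 'I_y.+1, is_tile x y'].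
  right=> x' hx'; apply: negbTE; apply/negP => t2.
  have ne : x' != x by apply: contraNneq hxy => <-.
  have ne' : y' != y by apply: contraNneq hxy => <-.
  by case: (@is_tile_antidiag x' y x y') => //; lia.
by left=> y' hy'; apply: negbTE; exact: (h1 (Ordinal (hy' : y' < y.+1))).
Qed.

(** By [tile_sum] the indices of the two tiles differ by 2, and the tile between them is adjacent to
    both. *)
Lemma is_tile_diag x y : is_tile x y -> is_tile x.+1 y.+1 ->
  is_tile x.+1 y || is_tile x y.+1.
Proof.
case/is_tileP=> i hi ei /is_tileP[j hj ej].
have := tile_sum hi; have := tile_sum hj; rewrite ei ej /= => sj si.
have hi' : i < plen w by lia.
have := is_tile_tile hi'; rewrite tileS // ei.
by case: ifP => _ /= ->; rewrite ?orbT.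
Qed.

Lemma is_snake_vertexE x y : is_snake_vertex w (x.+1, y.+1) =
  [|| is_tile x y, is_tile x.+1 y, is_tile x y.+1 | is_tile x.+1 y.+1].
Proof.
apply/existsP/idP => [[i]|].
  have := is_tile_tile (ltn_ord i : i <= _); case: (tile w i) => a b /= h.
  by rewrite !inE !xpair_eqE !eqSS; case/or4P=> /andP[/eqP-> /eqP->];
    rewrite h ?orbT.
by case/or4P => /existsP[i /eqP e]; exists i; rewrite e !inE eqxx ?orbT.
Qed.

(* The cells below or left ([cell_before]) and above or right ([cell_after]) of an
   edge. On the axes [.-1] yields a wrong cell, which is not a tile either. *)
Definition cell_before (e : edge) : bool :=
  let: (x, y, b) := e in if b then is_tile x y.-1 else is_tile x.-1 y.

Definition cell_after (e : edge) : bool := is_tile e.1.1 e.1.2.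

Lemma is_snake_edgeE e : is_snake_edge w e -> cell_before e || cell_after e.
Proof.
case: e => [[x y] b] /existsP[i].
have := is_tile_tile (ltn_ord i : i <= _); case: (tile w i) => c d /= h.
by rewrite !inE !xpair_eqE; case/or4P=> /andP[/andP[/eqP-> /eqP->] /eqP->];
  rewrite /cell_after /= h ?orbT.
Qed.

Lemma is_boundary_edgeN e : is_boundary_edge w e -> ~~ (cell_before e && cell_after e).
Proof.
case: e => [[x y] b] /cards1P[i0 e0]; apply/negP; rewrite /cell_after /=.
have uniq i j : (x, y, b) \in square_edges (tile w (i : 'I__)) ->
    (x, y, b) \in square_edges (tile w (j : 'I_(plen w).+1)) -> i = j.
  move=> hi hj; have : i \in [set i0] by rewrite -e0 inE.
  have : j \in [set i0] by rewrite -e0 inE.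
  by rewrite !inE => /eqP-> /eqP->.
case: b uniq {e0} => uniq /andP[hi hj].
  case: y uniq hi hj => [|y] uniq; first by rewrite is_tilex0.
  move=> /existsP[i /eqP ei] /existsP[j /eqP ej].
  suff ij : i = j by move: ei; rewrite ij ej => -[] /=; lia.
  by apply: uniq; rewrite ?ei ?ej /= !inE eqxx ?orbT.
case: x uniq hi hj => [|x] uniq; first by rewrite is_tile0y.
move=> /existsP[i /eqP ei] /existsP[j /eqP ej].
suff ij : i = j by move: ei; rewrite ij ej => -[] /=; lia.
by apply: uniq; rewrite ?ei ?ej /= !inE eqxx ?orbT.
Qed.

(** The summands are the four lattice edges at the point, so the covering condition takes the shape
    of a divergence; off the snake both sides are 0. *)
Lemma matching_degree (P : {fset edge}) x y : perfect_matching w P ->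
  (((x.+1, y.+1, true) \in P) + ((x, y.+1, true) \in P)
    + ((x.+1, y.+1, false) \in P) + ((x.+1, y, false) \in P))%N
  = is_snake_vertex w (x.+1, y.+1).
Proof.
case=> sub cov; case: (boolP (is_snake_vertex _ _)) => [/cov[e0 [[e0P e0p] e0u]]|].
  have mem e : (x.+1, y.+1) \in edge_ends e -> (e \in P) = (e == e0).
    by move=> ep; apply/idP/eqP => [h|->//]; rewrite (e0u e).
  rewrite !mem ?inE ?eqxx ?orbT //.
  case: e0 e0p {mem e0u e0P} => [[a b] []]; rewrite !inE !xpair_eqE !andbT !andbF;
  case/orP=> /andP[]; rewrite ?eqSS => /eqP<- /eqP<-; rewrite ?eqxx; lia.
rewrite is_snake_vertexE !negb_or => /and4P[/negPf h1 /negPf h2 /negPf h3 /negPf h4].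
have no e : ~~ (cell_before e || cell_after e) -> (e \in P) = false.
  by move=> h; apply: contraNF h => /sub/is_snake_edgeE.
by rewrite !no // /cell_after /= ?(h1, h2, h3, h4).
Qed.

End Staircase.

Local Opaque tile is_tile.

(** * Height functions of matchings *)

Section Height.
Variables (Q : quiver) (w : word Q).

(* Vertical boundary edges of T_1, T_3, ... and horizontal ones of T_2, T_4, ...;
   the parity of x + y tells them apart because T_{i+1} lies on the antidiagonal
   x + y = i + 2. *)
Definition ref_edge (e : edge) : bool :=
  if e.2 == odd (e.1.1 + e.1.2) then cell_after w e && ~~ cell_before w e
  else cell_before w e && ~~ cell_after w e.

(** The lattice is bipartite by the parity of x + y. Each edge of [P] carries one unit from its even
    to its odd end, each reference edge one unit back; the flow is measured in the direction of the
    coordinate axes. *)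
Definition flux (P : {fset edge}) (e : edge) : int :=
  let z := (e \in P)%:Z - (ref_edge e)%:Z in
  if odd (e.1.1 + e.1.2) then - z else z.

Lemma flux0 P e : perfect_matching w P -> cell_before w e = false ->
  cell_after w e = false -> flux P e = 0.
Proof.
case=> sub _ hb ha; rewrite /flux /ref_edge hb ha /= if_same subr0.
case: (boolP (e \in P)) => [/sub/is_snake_edgeE|_]; first by rewrite hb ha.
by rewrite oppr0 if_same.
Qed.

(** The divergence vanishes because the reference edges, like [P], meet each snake vertex once. This
    is checked for all configurations of the four surrounding cells except those excluded by [diag]
    and [anti]. *)
Lemma flux_vertex P x y : perfect_matching w P ->
  flux P (x.+1, y.+1, true) - flux P (x, y.+1, true)
    + flux P (x.+1, y.+1, false) - flux P (x.+1, y, false) = 0.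
Proof.
move=> /(@matching_degree _ _ _ x y).
rewrite is_snake_vertexE /flux /ref_edge /cell_after /= ?addSn ?addnS /=.
have diag := @is_tile_diag _ w x y.
have anti : is_tile w x y.+1 -> is_tile w x.+1 y -> False.
  exact: is_tile_antidiag.
move: (_ \in P) (_ \in P) (_ \in P) (_ \in P) (is_tile w x y) (is_tile w x.+1 y)
  (is_tile w x y.+1) (is_tile w x.+1 y.+1) diag anti => e1 e2 e3 e4 b1 b2 b3 b4.
case: b1 b2 b3 b4 => [] [] [] [] d a; try by [case: (a isT isT) | have := d isT isT];
  by case: e1 e2 e3 e4 => [] [] [] [] //; case: (odd _).
Qed.

(** The potential of the flow on the unit squares, integrated up a column from 0 on the bottom
    row. *)
Fixpoint height (P : {fset edge}) (x y : nat) : int :=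
  if y is y'.+1 then height P x y' + flux P (x, y, true) else 0.

Section Matching.
Variables (P : {fset edge}) (hP : perfect_matching w P).

Lemma heightU x y : height P x y.+1 - height P x y = flux P (x, y.+1, true).
Proof. by rewrite /= addrC addKr. Qed.

(** Path independence: from one row to the next the horizontal difference changes by the flux around
    one vertex, which is balanced by [flux_vertex]. *)
Lemma heightR x y : height P x y - height P x.+1 y = flux P (x.+1, y, false).
Proof.
elim: y => [|y IH] /=; first by rewrite flux0 // /cell_after /= is_tilex0.
have := flux_vertex x y hP; lia.
Qed.

(** No flux crosses the tile-free column or row that leads from the cell to an axis. *)
Lemma height_out x y : ~~ is_tile w x y -> height P x y = 0.
Proof.
case/out_col_or_row=> out.
  elim: y out => //= y IH out; rewrite IH => [|y' hy']; last by rewrite out // ltnW.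
  by rewrite flux0 // /cell_after /= out.
elim: x out => [|x IH] out.
  by elim: y {out} => //= y ->; rewrite flux0 // /cell_after /= is_tile0y.
have := heightR x y; rewrite IH => [|x' hx']; last by rewrite out // ltnW.
by rewrite flux0 /cell_after /= ?out //; lia.
Qed.

End Matching.
End Height.

Local Opaque height.

(** * Heights along the word *)

Section Joints.
Variables (Q : quiver) (w : word Q).

(** The edge shared by two consecutive tiles. It starts at the lower left corner of the second one,
    and a gluing to the right shares a vertical edge, whence the negation. *)
Definition joint (i : nat) : edge :=
  (tile w i.+1, ~~ nth false (gluings (arrows w)) i).

Lemma joint_sides i : (i < plen w)%N ->
  joint i \in square_edges (tile w i) /\ joint i \in square_edges (tile w i.+1).
Proof.
move=> hi; rewrite /joint tileS //; case: (tile w i) => x y.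
by case: (nth _ _ _) => /=; rewrite !inE !eqxx ?orbT.
Qed.

Lemma joint_inner i : (i < plen w)%N -> cell_before w (joint i) && cell_after w (joint i).
Proof.
move=> hi; have := is_tile_tile (ltnW hi); have := is_tile_tile hi.
rewrite /joint tileS //; case: (tile w i) => x y.
by rewrite /cell_after; case: (nth _ _ _) => /= -> ->.
Qed.

Lemma joint_dir i l : onth (arrows w) i = Some l ->
  (joint i).2 = is_direct l (+) ~~ odd i.
Proof. by move=> hl; rewrite /= (nth_gluings hl) addbN. Qed.

(** The vertex in front of the first inverse letter is a sink; if all letters are direct, the last
    vertex is one. *)
Lemma exists_sink : (0 < plen w)%N -> exists2 k, (k <= plen w)%N & is_sink w k.
Proof.
(* The default [true] makes [inv] false past the end, so [inv i] alone yields a letter. *)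
move=> n0; pose inv i := ~~ oapp (@is_direct _ _) true (onth (arrows w) i).
have dirP i : (i < plen w)%N -> ~~ inv i -> exists a, onth (arrows w) i = Some (inl a).
  rewrite /inv negbK /plen -onthTE; case: (onth _ i) => [[a|a]|] //=; by exists a.
have invP i : inv i -> exists a, onth (arrows w) i = Some (inr a).
  by rewrite /inv; case: (onth _ i) => [[a|a]|] //=; exists a.
have [/hasP ex|/hasPn none] := boolP (has inv (iota 0 (plen w))).
  have ex' : exists i, inv i by case: ex => i; exists i.
  case: (ex_minnP ex') => k hk kmin; have hkw : (k < plen w)%N.
    by case: ex => i; rewrite mem_iota => /andP[_ hi] /kmin hki; exact: leq_ltn_trans hki hi.
  exists k; first exact: ltnW.
  split=> [k0|_]; last exact: invP.
  apply: dirP; first by rewrite (leq_ltn_trans (leq_pred k)).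
  by apply/negP => /kmin; rewrite leqNgt ltn_predL k0.
exists (plen w) => //; split=> [_|]; last by rewrite ltnn.
apply: dirP; first by rewrite ltn_predL.
by apply: none; rewrite mem_iota /= ltn_predL.
Qed.

(** The cells below and to the left of a tile are not both tiles. *)
Lemma exists_side x y : is_tile w x y -> exists2 e, e \in square_edges (x, y) &
  ~~ (cell_before w e && cell_after w e).
Proof.
case: y => [|y]; first by rewrite is_tilex0.
case: x => [|x h]; first by rewrite is_tile0y.
have [h'|h'] := boolP (is_tile w x.+1 y); last first.
  by exists (x.+1, y.+1, true); rewrite ?inE ?eqxx ?orbT //= negb_and h'.
exists (x.+1, y.+1, false); rewrite ?inE ?eqxx ?orbT //= /cell_after h andbT.
by apply/negP => h2; case: (is_tile_antidiag _ _ h2 h').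
Qed.

Section Matching.
Variables (P : {fset edge}) (hP : perfect_matching w P).

(** The cell across [e] has height 0, so the height is the flux through [e] up to sign. For such a
    side, [e.2 == odd (x + y)] says that [e] is a reference edge: the tile has height 1 iff [P] and
    the reference matching differ at [e]. *)
Lemma height_side x y e : is_tile w x y -> e \in square_edges (x, y) ->
  ~~ (cell_before w e && cell_after w e) ->
  height w P x y = ((e \in P) (+) (e.2 == odd (x + y)))%:Z.
Proof.
case: y => [|y]; first by rewrite is_tilex0.
case: x => [|x h]; first by rewrite is_tile0y.
rewrite !inE => /or4P[] /eqP-> /=; rewrite /cell_after /= h ?andbT /= => h'.
- have := heightU w P x.+1 y; rewrite (height_out hP h').
  rewrite /flux /ref_edge /cell_after /= h h' andbT andbF.
  by case: (_ \in P); case: (odd _) => /=; lia.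
- have := heightU w P x.+1 y.+1; rewrite (height_out hP h').
  rewrite /flux /ref_edge /cell_after /= h (negbTE h') addnS /=.
  by case: (_ \in P); case: (odd _) => /=; lia.
- have := heightR hP x y.+1; rewrite (height_out hP h').
  rewrite /flux /ref_edge /cell_after /= h h' andbT andbF.
  by case: (_ \in P); case: (odd _) => /=; lia.
- have := heightR hP x.+1 y.+1; rewrite (height_out hP h').
  rewrite /flux /ref_edge /cell_after /= h (negbTE h') ?addSn /=.
  by case: (_ \in P); case: (odd _) => /=; lia.
Qed.

Definition tile_height (i : nat) : int := height w P (tile w i).1 (tile w i).2.

Lemma tile_height_bool i : (i <= plen w)%N -> tile_height i = 0 \/ tile_height i = 1.
Proof.
move=> hi; have ht := is_tile_tile hi; have [e he hb] := exists_side ht.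
by rewrite /tile_height (height_side ht he hb); case: (_ (+) _); [right|left].
Qed.

(** Joints are not reference edges, so only [P] contributes to the flux. Its sign depends on the
    gluing and the parity of [i], which [nth_gluings] combines into the direction of the letter. *)
Lemma tile_height_joint i l : onth (arrows w) i = Some l ->
  if is_direct l then tile_height i.+1 = tile_height i + (joint i \in P)%:Z
  else tile_height i = tile_height i.+1 + (joint i \in P)%:Z.
Proof.
move=> hl; have hi : (i < plen w)%N by rewrite /plen -onthTE hl.
have := joint_inner hi; have := tile_sum (ltnW hi); have := nth_gluings hl.
rewrite /tile_height /joint /cell_after tileS //; case: (tile w i) => x y.
case: (nth _ _ _) => /= eg sxy /andP[h1 h2].
  have := heightR hP x y; rewrite /flux /ref_edge /cell_after /= h1 h2 /= if_same sxy /=.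
  by case: (is_direct l) eg; case: (odd i); case: (_ \in P) => //= _; lia.
have := heightU w P x y; rewrite /flux /ref_edge /cell_after /= h1 h2 /= if_same addnS sxy /=.
by case: (is_direct l) eg; case: (odd i); case: (_ \in P) => //= _; lia.
Qed.

End Matching.

(** A boundary matching contains no joint, so its height is constant. Height 1 at a sink would leave
    at most one boundary edge of the sink tile in [Pmin]. *)
Lemma minimal_height Pmin i : (0 < plen w)%N -> minimal_matching w Pmin ->
  (i <= plen w)%N -> tile_height Pmin i = 0.
Proof.
move=> n0 [hPm hbd hsink].
have const j k : (j <= k <= plen w)%N -> tile_height Pmin j = tile_height Pmin k.
  case/andP; elim: k => [|k IH]; first by case: j.
  rewrite leq_eqVlt => /predU1P[-> //|hjk] hk; rewrite (IH hjk (ltnW hk)).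
  case hl: (onth (arrows w) k) => [l|]; last by move: hk; rewrite /plen -onthTE hl.
  have /negbTE jP : joint k \notin Pmin.
    by apply: contraL (joint_inner hk) => /hbd/is_boundary_edgeN.
  by have := tile_height_joint hPm hl; rewrite jP addr0; case: ifP => _ ->; rewrite ?addr0.
have [k hk sk] := exists_sink n0.
suff Hk : tile_height Pmin k = 0.
  by move=> hi; case: (leqP i k) => hik;
    [rewrite (const i k) ?hik|rewrite -(const k i) ?hi ?(ltnW hik)].
have [//|Hk] := tile_height_bool hPm hk.
have := hsink (Ordinal (hk : k < (plen w).+1)%N) sk => /=.
(* Next to a sink the letter before is direct and the one after inverse, so by [joint_dir] either
   joint has this orientation; the one before is taken unless [k] is 0. *)
have [j [hj1 hj2 hj3]] : exists j, [/\ j \in square_edges (tile w k),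
    cell_before w j && cell_after w j & j.2 = ~~ odd k].
  case: sk => s1 s2; have [k0|] := posnP k.
    have [a ha] := s2 (eq_ind_r (fun k => k < plen w)%N n0 k0).
    by exists (joint k); rewrite (joint_dir ha) joint_inner ?k0 //; have [] := @joint_sides 0 n0.
  case: k {Hk s2} hk s1 => // k hk /(_ isT)[a ha] _.
  by exists (joint k); rewrite (joint_dir ha) joint_inner //; have [] := joint_sides hk.
have ht := is_tile_tile hk.
(* At height 1 a boundary edge in [Pmin] is not a reference edge, so it is parallel to [j]. Only the
   side opposite to [j] remains. *)
have key e : e \in square_edges (tile w k) -> is_boundary_edge w e && (e \in Pmin) ->
    (e.2 != odd k) && (e != j).
  move=> he /andP[/is_boundary_edgeN hb eP]; apply/andP; split; last first.
    by apply: contraNneq hb => ->.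
  have := Hk; rewrite /tile_height (@height_side _ hPm _ _ e) -?surjective_pairing //.
  by rewrite tile_sum //= negbK eP; case: (_ == _).
move=> c2; suff : (count (fun e => is_boundary_edge w e && (e \in Pmin))
    (square_edges (tile w k)) <= 1)%N by rewrite c2.
rewrite (@eq_in_count _ _ (fun e => [&& is_boundary_edge w e && (e \in Pmin),
  e.2 != odd k & e != j])) => [|e he]; last first.
  by case: (boolP (_ && _)) => //= /(key e he).
apply: (leq_trans (sub_count (a2 := fun e => (e.2 != odd k) && (e != j)) _ _)) => [e|].
  by case/andP.
move: hj1 hj3; case: (tile w k) j {key hj2} => x y [[a b] d].
rewrite !inE => /or4P[] /eqP[-> -> ->] /=; rewrite !xpair_eqE ?eqxx ?andbF ?andbT /=;
  by case: (odd k) => //=; case: (_ == _).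
Qed.

End Joints.

(** * Enclosed tiles *)

Section Enclosed.
Variables (Q : quiver) (w : word Q).
Local Notation grid_cell x y := ((inord x, inord y) : cell w).

Lemma crossableR (D : {fset edge}) x y : (x <= (plen w).+1)%N -> (y <= (plen w).+2)%N ->
  (x.+1, y, false) \notin D ->
  crossable D (grid_cell x y) (grid_cell x.+1 y)
    /\ crossable D (grid_cell x.+1 y) (grid_cell x y).
Proof.
move=> hx hy hD; have hx' := leqW hx; have hy' := leqW hy.
by split; rewrite /crossable /= !inordK // !eqxx hD ?orbT.
Qed.

Lemma crossableU (D : {fset edge}) x y : (x <= (plen w).+2)%N -> (y <= (plen w).+1)%N ->
  (x, y.+1, true) \notin D ->
  crossable D (grid_cell x y) (grid_cell x y.+1)
    /\ crossable D (grid_cell x y.+1) (grid_cell x y).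
Proof.
move=> hx hy hD; have hx' := leqW hx; have hy' := leqW hy.
by split; rewrite /crossable /= !inordK // !eqxx hD ?orbT.
Qed.

Variable D : {fset edge}.
Hypothesis hD : forall e, e \in D -> cell_before w e || cell_after w e.

Let notinD e : cell_before w e = false -> cell_after w e = false -> e \notin D.
Proof. by move=> h1 h2; apply/negP => /hD; rewrite h1 h2. Qed.

(** Edges of [D] border a tile, so the way along a tile-free column or row to an axis, and then
    along the axis, crosses none of them. *)
Lemma connect_out x y : (x <= (plen w).+2)%N -> (y <= (plen w).+2)%N ->
  ~~ is_tile w x y -> connect (crossable D) (grid_cell x y) (ord0, ord0).
Proof.
have -> : (ord0, ord0) = grid_cell 0 0 by congr (_, _); apply: val_inj; rewrite /= inordK.
have down x' y' : (x' <= (plen w).+2)%N -> (y' <= (plen w).+2)%N ->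
    (forall z, (z <= y')%N -> is_tile w x' z = false) ->
    connect (crossable D) (grid_cell x' y') (grid_cell x' 0).
  move=> hx; elim: y' => // z IH hz out.
  apply: connect_trans (IH (ltnW hz) _) => [|z' hz']; last by rewrite out // ltnW.
  apply: connect1; case: (@crossableU D x' z hx hz _) => //.
  by rewrite notinD //= /cell_after /= out.
have left x' y' : (x' <= (plen w).+2)%N -> (y' <= (plen w).+2)%N ->
    (forall z, (z <= x')%N -> is_tile w z y' = false) ->
    connect (crossable D) (grid_cell x' y') (grid_cell 0 y').
  move=> + hy; elim: x' => // z IH hz out.
  apply: connect_trans (IH (ltnW hz) _) => [|z' hz']; last by rewrite out // ltnW.
  apply: connect1; case: (@crossableR D z y' hz hy _) => //.
  by rewrite notinD //= /cell_after /= out.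
move=> hx hy /out_col_or_row[out|out].
  apply: connect_trans (down _ _ hx hy out) _.
  by apply: left => // z _; exact: is_tilex0.
apply: connect_trans (left _ _ hx hy out) _.
by apply: down => // z _; exact: is_tile0y.
Qed.

Lemma connect_tile x y e : is_tile w x y -> e \in square_edges (x, y) ->
  e \notin D -> ~~ (cell_before w e && cell_after w e) ->
  connect (crossable D) (grid_cell x y) (ord0, ord0).
Proof.
move=> ht; have [] := is_tile_bounds ht; case: x ht => // x; case: y => // y ht hx hy.
rewrite !inE => /or4P[] /eqP-> hDe; rewrite /cell_after /= ht ?andbT /= => out.
- by apply: (connect_trans (connect1 (proj2 (crossableU _ _ hDe))) (connect_out _ _ out)); lia.
- by apply: (connect_trans (connect1 (proj1 (crossableU _ _ hDe))) (connect_out _ _ out)); lia.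
- by apply: (connect_trans (connect1 (proj2 (crossableR _ _ hDe))) (connect_out _ _ out)); lia.
- by apply: (connect_trans (connect1 (proj1 (crossableR _ _ hDe))) (connect_out _ _ out)); lia.
Qed.

End Enclosed.

(** * Enclosure by a symmetric difference in terms of heights *)

Section Matchings.
Variables (Q : quiver) (w : word Q) (P P' : {fset edge}).
Hypotheses (hP : perfect_matching w P) (hP' : perfect_matching w P').
Local Notation D := (symdiff P P').

Lemma in_symdiff e : (e \in D) = (e \in P) (+) (e \in P').
Proof. by rewrite !inE; case: (e \in P); case: (e \in P'). Qed.

(** Two matchings have the same flux through every edge off their symmetric difference. *)
Lemma crossable_height (c c' : cell w) : crossable D c c' ->
  height w P c.1 c.2 - height w P' c.1 c.2 = height w P c'.1 c'.2 - height w P' c'.1 c'.2.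
Proof.
have flux_eq e : e \notin D -> flux w P e = flux w P' e.
  by rewrite in_symdiff /flux; case: (e \in P); case: (e \in P').
case: c c' => c1 c2 [c1' c2']; rewrite /crossable /=.
case/or4P=> /and3P[/eqP e1 /eqP e2 /flux_eq]; rewrite ?e1 ?e2.
- by rewrite -(heightR hP) -(heightR hP'); lia.
- by rewrite -(heightR hP) -(heightR hP'); lia.
- by rewrite -heightU -heightU; lia.
- by rewrite -heightU -heightU; lia.
Qed.

Lemma connect_height (c c' : cell w) : connect (crossable D) c c' ->
  height w P c.1 c.2 - height w P' c.1 c.2 = height w P c'.1 c'.2 - height w P' c'.1 c'.2.
Proof.
case/connectP=> s + ->; elim: s c => //= c1 s IH c /andP[/crossable_height-> ].
exact: IH.
Qed.

(** The difference of the heights is 0 at the outer cell and constant along crossings. Conversely,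
    if the heights agree, [height_side] shows that [P] and [P'] agree at a side facing a non-tile,
    and this side is a way out. *)
Lemma enclosedE (i : 'I_(plen w).+1) :
  (i \in enclosed w D) = (tile_height w P i != tile_height w P' i).
Proof.
have ht := is_tile_tile (ltn_ord i : (i <= plen w)%N).
have [/andP[_ /leqW hx] /andP[_ /leqW hy]] := is_tile_bounds ht.
rewrite inE; congr (~~ _); apply/idP/eqP => [/connect_height|].
  rewrite /= !inordK // (@height_out _ _ _ hP 0) ?is_tile0y //.
  by rewrite (@height_out _ _ _ hP' 0) ?is_tile0y // => /subr0_eq.
have [e he hb] := exists_side ht.
rewrite /tile_height (height_side hP ht he hb) (height_side hP' ht he hb) => hPP'.
apply: (connect_tile _ ht he _ hb).
  move=> f; rewrite in_symdiff => hf; apply: is_snake_edgeE.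
  case: hP hP' => s _ [s' _]; move: hf; case hf: (f \in P); first by move=> _; apply: s.
  by move/s'.
rewrite in_symdiff; move: hPP'.
by case: (e \in P); case: (e \in P'); case: (_ == _).
Qed.

End Matchings.

(** Enclosed tiles are those of height 1 for [P], and by [tile_height_joint] the height does not
    drop along an arrow. Any move needs a letter, so [minimal_height] applies. *)
Lemma enclosed_moves (Q : quiver) (w : word Q) Pmin P (a : Q1 Q) (i j : 'I_(plen w).+1) :
  minimal_matching w Pmin -> perfect_matching w P -> moves w a i j ->
  i \in enclosed w (symdiff P Pmin) -> j \in enclosed w (symdiff P Pmin).
Proof.
move=> hm hP mv; have [hPm _ _] := hm.
have n0 : (0 < plen w)%N.
  rewrite lt0n; apply: contraTneq mv => n0.
  by rewrite /moves; case: i j => [i hi] [j hj] /=; rewrite negb_or; lia.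
have hi := ltn_ord i : (i <= plen w)%N; have hj := ltn_ord j : (j <= plen w)%N.
rewrite !enclosedE // !(minimal_height _ hm) //.
have [hi0|hi1] := tile_height_bool hP hi; first by rewrite hi0.
have [hj0|hj1] := tile_height_bool hP hj; last by rewrite hj1.
case/orP: mv => /andP[/eqP e /eqP hl]; have := tile_height_joint hP hl; rewrite -e /= hi1 hj0.
  by case: (_ \in P).
by case: (_ \in P).
Qed.

(** * The submodule of a set of tiles *)

Section Subpaths.
Variables (Q : quiver) (p : qpath Q) (i k : nat).

Lemma plen_subpath : (k <= plen p)%N -> plen (subpath p i k) = (k - i)%N.
Proof.
by rewrite /plen /arrows /= size_take_min size_drop => hk; apply/minn_idPl/leq_sub2r.
Qed.

Lemma vertex_subpath l : (k <= plen p)%N -> (l <= k - i)%N ->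
  vertex (subpath p i k) l = vertex p (i + l).
Proof.
rewrite /vertex /plen /start /arrows /=; case: l => [|l] hk hl /=; first by rewrite addn0.
rewrite addnS /= map_take nth_take // map_drop nth_drop.
by apply: set_nth_default; rewrite size_map; apply: leq_trans hk; lia.
Qed.

Lemma onth_subpath l : (l < k - i)%N ->
  onth (arrows (subpath p i k)) l = onth (arrows p) (i + l).
Proof.
by move=> hl; rewrite [arrows (subpath _ _ _)]/= !onthE map_take nth_take // map_drop nth_drop.
Qed.

End Subpaths.

Lemma moves_subpath (Q : quiver) (w : word Q) i k a l l' :
  (l <= k - i)%N -> (l' <= k - i)%N ->
  moves (subpath w i k) a l l' = moves w a (i + l) (i + l').
Proof.
move=> hl hl'; rewrite /moves -!addnS !eqn_add2l; congr (_ || _).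
  by case: eqP => // e; rewrite onth_subpath //; lia.
by case: eqP => // e; rewrite onth_subpath //; lia.
Qed.

Section Submodules.
Variables (K : fieldType) (Q : quiver).

Lemma kq_act_hom m n (M : kqmod K Q m) (N : kqmod K Q n) (F : 'M[K]_(m, n)) x :
  is_hom M N F -> kq_act M x *m F = F *m kq_act N x.
Proof.
case=> hv ha; rewrite /kq_act.
rewrite (lext_comp (h := mulmx^~ F)); last 2 first.
- by move=> u v; rewrite mulmxDl.
- by move=> c u; rewrite scalemxAl.
rewrite (lext_comp (h := mulmx F)); last 2 first.
- by move=> u v; rewrite mulmxDr.
- by move=> c u; rewrite scalemxAr.
apply: eq_lext => p; rewrite /path_act.
elim/last_ind: (arrows p) => [|s a IH]; first exact: hv.
by rewrite !foldl_rcons -mulmxA ha !mulmxA IH.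
Qed.

(** The action of [x] on [M] followed by [F] is [F] followed by the action on [N], hence 0, and [F]
    can be cancelled. *)
Lemma is_Amod_embedding I m n (M : kqmod K Q m) (N : kqmod K Q n) (F : 'M[K]_(m, n)) :
  is_embedding M N F -> is_Amod I N -> is_Amod I M.
Proof.
move=> [hF free] hN x /hN Nx; apply: (row_free_inj free).
by rewrite /= (kq_act_hom _ hF) Nx mulmx0 mul0mx.
Qed.

Lemma is_submod_hom m n (M : kqmod K Q m) (N : kqmod K Q n) (F : 'M[K]_(m, n)) :
  is_hom M N F -> is_submod N F.
Proof. by case=> hv ha; split=> z; rewrite -?hv -?ha submxMl. Qed.

End Submodules.

Lemma coisometry_row_free (K : fieldType) m n (E : 'M[K]_(m, n)) :
  E *m E^T = 1%:M -> row_free E.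
Proof. by move=> hE; apply/row_freeP; exists E^T. Qed.

(** Applied to matrices whose rows are distinct basis vectors: [E^T *m E] is then the diagonal
    projection onto their span. *)
Lemma coisometry_eqmx (K : fieldType) m n (E : 'M[K]_(m, n)) :
  E *m E^T = 1%:M -> (E == E^T *m E)%MS.
Proof.
move=> hE; rewrite submxMl andbT; apply/submxP; exists E.
by rewrite mulmxA hE mul1mx.
Qed.

Lemma rank_basis_span (K : fieldType) (Q : quiver) (w : word Q)
    (T : {set 'I_(plen w).+1}) : \rank (basis_span w K T) = #|T|.
Proof.
pose E : 'M[K]_(#|T|, (plen w).+1) := \matrix_(k, i) (enum_val k == i)%:R.
have EE : E *m E^T = 1%:M.
  apply/matrixP=> k l; rewrite !mxE (bigD1 (enum_val k)) //= big1 => [|i ne].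
    by rewrite !mxE eqxx mul1r addr0 (inj_eq enum_val_inj) eq_sym.
  by rewrite !mxE eq_sym (negPf ne) mul0r.
have -> : basis_span w K T = E^T *m E.
  apply/matrixP=> i j; rewrite !mxE; have [iT|iT] := boolP (i \in T); last first.
    rewrite andbF big1 // => k _; rewrite !mxE; case: eqP => [e|_]; last by rewrite mul0r.
    by case/negP: iT; rewrite -e enum_valP.
  rewrite (bigD1 (enum_rank_in iT i)) //= big1 => [|k ne].
    by rewrite !mxE enum_rankK_in // eqxx mul1r addr0 andbT.
  rewrite !mxE; case: eqP => [e|_]; last by rewrite mul0r.
  by case/eqP: ne; apply: enum_val_inj; rewrite enum_rankK_in.
by rewrite -(eqmxP (coisometry_eqmx EE)); apply/eqP; exact: coisometry_row_free.
Qed.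

(** * Maximal runs of tiles and the map from their string modules *)

Section Runs.
Variables (Q : quiver) (w : word Q) (S : {set 'I_(plen w).+1}).

Definition run_first (j : 'I_#|runs w S|) : nat := run_start w S j.
Definition run_last (j : 'I_#|runs w S|) : nat := (enum_val j).2.
Local Notation inrun j i := (run_first j <= i <= run_last j)%N.

Lemma runP (j : 'I_#|runs w S|) :
  [/\ (run_first j <= run_last j)%N, (run_last j <= plen w)%N,
      forall i : 'I_(plen w).+1, inrun j i -> i \in S,
      forall i : 'I_(plen w).+1, i.+1 = run_first j -> i \notin S
    & forall i : 'I_(plen w).+1, i = (run_last j).+1 :> nat -> i \notin S].
Proof.
have := enum_valP j; rewrite inE => /and4P[h1 /forallP h2 /forallP h3 /forallP h4].
split=> // [|i|i e|i e]; first exact: (ltn_ord (enum_val j).2).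
- exact: (implyP (h2 i)).
- by apply: (implyP (h3 i)); apply/eqP.
- by apply: (implyP (h4 i)); apply/eqP.
Qed.

(** A step out of the run would end right before its start or right after its end, where maximality
    excludes [S]. *)
Lemma run_next (j : 'I_#|runs w S|) (i i' : 'I_(plen w).+1) :
  (i' == i.+1 :> nat) || (i == i'.+1 :> nat) -> i' \in S -> inrun j i -> inrun j i'.
Proof.
have [_ _ _ hl hr] := runP j => ii' hS hi.
have h1 : i'.+1 <> run_first j by move=> /hl; rewrite hS.
have h2 : i' <> (run_last j).+1 :> nat by move=> /hr; rewrite hS.
lia.
Qed.

(** The run has the least start and the greatest end for which all tiles between that end point and
    [i] lie in [S]. *)
Lemma run_exists (i : 'I_(plen w).+1) : i \in S -> exists j : 'I_#|runs w S|, inrun j i.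
Proof.
move=> iS; pose left s := (s <= i)%N && [forall l : 'I_(plen w).+1, (s <= l <= i)%N ==> (l \in S)].
pose right t := (i <= t <= plen w)%N &&
  [forall l : 'I_(plen w).+1, (i <= l <= t)%N ==> (l \in S)].
have i1 (l : 'I_(plen w).+1) : (i <= l <= i)%N -> l \in S.
  by rewrite -eqn_leq => /eqP/val_inj<-.
have exl : exists s, left s.
  by exists i; rewrite /left leqnn; apply/forallP=> l; apply/implyP/i1.
have exr : exists t, right t.
  by exists i; rewrite /right leqnn -ltnS ltn_ord; apply/forallP=> l; apply/implyP/i1.
have maxr t : right t -> (t <= plen w)%N by case/andP=> /andP[].
case: (ex_minnP exl) => s /andP[si /forallP sS] smin.
case: (ex_maxnP exr maxr) => t /andP[/andP[it tw] /forallP tS] tmax.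
have sw : (s < (plen w).+1)%N by apply: leq_ltn_trans si (ltn_ord i).
have inr : (Ordinal sw, Ordinal (tw : (t < (plen w).+1)%N)) \in runs w S.
  rewrite inE /=; apply/and4P; split; first exact: leq_trans si it.
  - apply/forallP=> l; apply/implyP=> /andP[h1 h2].
    case: (leqP l i) => hl; first by apply: (implyP (sS l)); rewrite h1.
    by apply: (implyP (tS l)); rewrite h2 ltnW.
  - apply/forallP=> l; apply/implyP=> /eqP e; apply/negP => lS.
    suff /smin : left l by lia.
    apply/andP; split; first lia.
    apply/forallP=> l'; apply/implyP=> /andP[h1 h2].
    move: h1; rewrite leq_eqVlt => /predU1P[/val_inj<- //|h1].
    by apply: (implyP (sS l')); rewrite h2 andbT -e.
  apply/forallP=> l; apply/implyP=> /eqP e; apply/negP => lS.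
  have lw := ltn_ord l.
  suff /tmax : right l by lia.
  apply/andP; split; first lia.
  apply/forallP=> l'; apply/implyP=> /andP[h1 h2].
  move: h2; rewrite leq_eqVlt => /predU1P[/val_inj-> //|h2].
  by apply: (implyP (tS l')); rewrite h1 /= -ltnS -e.
exists (enum_rank_in inr (Ordinal sw, Ordinal (tw : (t < (plen w).+1)%N))).
by rewrite /run_first /run_last /run_start enum_rankK_in //= si.
Qed.

(** If one of two runs through [i] extended beyond the other, it would contain the tile next to the
    end of the other, which is not in [S]. *)
Lemma run_inj (j k : 'I_#|runs w S|) (i : 'I_(plen w).+1) :
  inrun j i -> inrun k i -> j = k.
Proof.
have le_first j' k' : inrun j' i -> inrun k' i -> (run_first j' <= run_first k')%N.
  have [_ _ _ hl _] := runP j'; have [_ _ hS _ _] := runP k' => hj hk.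
  rewrite leqNgt; apply/negP => lt.
  have p0 : ((run_first j').-1 < (plen w).+1)%N by have := ltn_ord i; lia.
  have /hl/negP[] : (Ordinal p0).+1 = run_first j' by rewrite /= prednK //; lia.
  by apply: hS => /=; lia.
have le_last j' k' : inrun j' i -> inrun k' i -> (run_last k' <= run_last j')%N.
  have [_ _ _ _ hr] := runP j'; have [_ hw hS _ _] := runP k' => hj hk.
  rewrite leqNgt; apply/negP => lt.
  have p0 : ((run_last j').+1 < (plen w).+1)%N by lia.
  have /hr/negP[] : Ordinal p0 = (run_last j').+1 :> nat by [].
  by apply: hS => /=; lia.
move=> hj hk; apply: enum_val_inj; rewrite [LHS]surjective_pairing [RHS]surjective_pairing.
have e1 : run_first j = run_first k by apply/eqP; rewrite eqn_leq !le_first.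
have e2 : run_last j = run_last k by apply/eqP; rewrite eqn_leq !le_last.
by congr (_, _); apply: val_inj.
Qed.

Lemma plen_run (j : 'I_#|runs w S|) : plen (run_word w S j) = (run_last j - run_first j)%N.
Proof. by have [_ hw _ _ _] := runP j; exact: plen_subpath. Qed.

Lemma run_lt (j : 'I_#|runs w S|) l : (l <= plen (run_word w S j))%N ->
  (run_first j + l <= run_last j)%N.
Proof. by rewrite plen_run; have [] := runP j; lia. Qed.

Lemma run_vertex (j : 'I_#|runs w S|) l : (l <= plen (run_word w S j))%N ->
  vertex (run_word w S j) l = vertex w (run_first j + l).
Proof. by rewrite plen_run; have [_ hw _ _ _] := runP j; exact: vertex_subpath. Qed.

Lemma run_moves (j : 'I_#|runs w S|) a l l' : (l <= plen (run_word w S j))%N ->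
  (l' <= plen (run_word w S j))%N ->
  moves (run_word w S j) a l l' = moves w a (run_first j + l) (run_first j + l').
Proof. by rewrite plen_run; exact: moves_subpath. Qed.

Variable K : fieldType.

Definition run_mx (j : 'I_#|runs w S|) : 'M[K]_((plen (run_word w S j)).+1, (plen w).+1) :=
  \matrix_(l, i) (i == (run_first j + l)%N :> nat)%:R.

Lemma run_mapE : run_map w K S = \mxcol_j run_mx j.
Proof. by []. Qed.

Lemma run_pos (j : 'I_#|runs w S|) (l : 'I_(plen (run_word w S j)).+1) :
  {i : 'I_(plen w).+1 | i = (run_first j + l)%N :> nat & inrun j i}.
Proof.
have hl := run_lt (ltn_ord l : (l <= _)%N).
have hw : (run_first j + l < (plen w).+1)%N by have [] := runP j; lia.
by exists (Ordinal hw); rewrite //= leq_addr.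
Qed.

Lemma run_mxM n (X : 'M[K]_((plen w).+1, n)) j (l : 'I__) (i : 'I_(plen w).+1) k :
  i = (run_first j + l)%N :> nat -> (run_mx j *m X) l k = X i k.
Proof.
move=> e; rewrite mxE (bigD1 i) //= big1 => [|i' ne].
  by rewrite mxE e eqxx mul1r addr0.
by rewrite mxE -e (inj_eq (@ord_inj _)) (negPf ne) mul0r.
Qed.

(** Off the run the index given by [inord] and truncated subtraction is meaningless; the guard keeps
    it from being used. *)
Lemma mul_run_mx n j (Y : 'M[K]_(n, _)) k (i : 'I_(plen w).+1) :
  (Y *m run_mx j) k i =
    if inrun j i then Y k (inord (i - run_first j)) else 0.
Proof.
have [hr hw _ _ _] := runP j; rewrite mxE; case: ifP => hi.
  have e : (i - run_first j < (plen (run_word w S j)).+1)%N by rewrite plen_run; lia.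
  rewrite (bigD1 (inord (i - run_first j))) //= big1 => [|l ne].
    rewrite mxE inordK // subnKC; last by case/andP: hi.
    by rewrite eqxx mulr1 addr0.
  rewrite mxE; case: eqP => [e'|_]; last by rewrite mulr0.
  by case/eqP: ne; apply: val_inj; rewrite /= inordK // e' addKn.
rewrite big1 // => l _; rewrite mxE; case: eqP => [e|_]; last by rewrite mulr0.
have := run_lt (ltn_ord l : (l <= _)%N); move: e hi; lia.
Qed.

(** The rows are distinct basis vectors: positions within a run are distinct, and different runs are
    disjoint by [run_inj]. *)
Lemma run_map_coisometry : run_map w K S *m (run_map w K S)^T = 1%:M.
Proof.
rewrite run_mapE tr_mxcol mul_mxcol_mxrow -mxdiagZ; apply: eq_mxblock => j k.
case: eqVneq => [e|ne].
  case: _ / e; rewrite conform_mx_id; apply/matrixP=> l l'; have [i ei _] := run_pos l.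
  by rewrite (run_mxM _ _ ei) !mxE ei eqn_add2l.
apply/matrixP=> l l'; have [i ei hi] := run_pos l; have [i' ei' hi'] := run_pos l'.
rewrite (run_mxM _ _ ei) !mxE; case: eqP => // e; case/eqP: ne; apply: (run_inj hi).
by rewrite (ord_inj (etrans e (esym ei'))).
Qed.

(** On the diagonal of the product each [i'] in [S] gets exactly one contribution, from the only run
    through it. *)
Lemma run_map_basis_span : (run_map w K S == basis_span w K S)%MS.
Proof.
suff -> : basis_span w K S = (run_map w K S)^T *m run_map w K S.
  exact: coisometry_eqmx run_map_coisometry.
rewrite run_mapE tr_mxcol mul_mxrow_mxcol; apply/matrixP=> i i'; rewrite summxE mxE.
under eq_bigr do rewrite mul_run_mx.
have entry j : inrun j i' ->
    (run_mx j)^T i (inord (i' - run_first j)) = (i == i')%:R.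
  move=> hi'; rewrite !mxE inordK; last by rewrite plen_run; lia.
  by rewrite subnKC //; case/andP: hi'.
have [iS|iS] := boolP (i' \in S); last first.
  rewrite big1 => [|j _].
    by case: eqP => // ->; rewrite (negPf iS).
  by case: ifP => // hi'; case: (runP j) => _ _ /(_ _ hi'); rewrite (negPf iS).
have [j hj] := run_exists iS; rewrite (bigD1 j) //= hj entry // big1 => [|k ne].
  by rewrite addr0; case: eqP => //= ->; rewrite iS.
by case: ifP => // hk; case/eqP: ne; apply: run_inj hk hj.
Qed.

Hypothesis hS : forall a (i j : 'I_(plen w).+1), moves w a i j -> i \in S -> j \in S.

(** Inside a run the actions agree letter by letter. An arrow of [w] starting in a run stays in [S]
    by [hS], hence in the run by [run_next]. *)
Lemma run_map_hom : is_hom (run_mod w K S) (string_mod K w) (run_map w K S).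
Proof.
split=> z; rewrite run_mapE /= mul_mxdiag_mxcol mxcol_mul; apply: eq_mxcol => j;
  apply/matrixP=> l i'; have [i ei hi] := run_pos l; rewrite (run_mxM _ _ ei) mul_run_mx !mxE;
  have hl := ltn_ord l : (l <= _)%N.
  case: ifP => hi'.
    have hi2 : (i' - run_first j < (plen (run_word w S j)).+1)%N by rewrite plen_run; lia.
    rewrite run_vertex // -ei -!val_eqE /= inordK // -(eqn_add2l (run_first j)) -ei subnKC //.
    by case/andP: hi'.
  by case: eqP => // e; rewrite -e hi in hi'.
case: ifP => hi'.
  have hi2 : (i' - run_first j < (plen (run_word w S j)).+1)%N by rewrite plen_run; lia.
  by rewrite inordK // run_moves // -ei subnKC //; case/andP: hi'.
case: (boolP (moves _ _ _ _)) => // mv.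
suff : inrun j i' by rewrite hi'.
have [_ _ /(_ _ hi) iS _ _] := runP j; apply: run_next hi; last exact: hS mv iS.
by case/orP: mv => /andP[-> _]; rewrite ?orbT.
Qed.

(** Composing with the injective map keeps the rank and moves the idempotent to [M(w)], where it
    cuts out the basis vectors in [S] at [v]. *)
Lemma run_mod_dimvec v : dimvec (run_mod w K S) v = face w S v.
Proof.
rewrite /dimvec -(mxrankMfree _ (coisometry_row_free run_map_coisometry)).
case: run_map_hom => -> _; rewrite (eqmxMr _ (eqmxP run_map_basis_span)).
rewrite /face -(rank_basis_span K); congr (\rank _).
apply/matrixP=> i j; rewrite string_mul_idem !mxE inE.
by case: (eqVneq i j) => [->|_] /=; [case: eqP; rewrite ?andbT ?andbF|case: eqP].
Qed.

End Runs.

Theorem proposition3p1 (K : fieldType) (Q : quiver)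
    (I : path_algebra K Q -> Prop) (hI : admissible I)
    (w : word Q) (hw : is_string I w)
    (Pmin : {fset edge}) (hPmin : minimal_matching w Pmin)
    (P : {fset edge}) (hP : perfect_matching w P) :
  let S := enclosed w (symdiff P Pmin) in
  let MP := run_mod w K S in
  let Mw := string_mod K w in
  let phi := run_map w K S in
  [/\ is_embedding MP Mw phi,
      is_canonical_submod w phi /\ (phi == basis_span w K S)%MS,
      is_Amod I Mw -> is_Amod I MP
    & forall v : Q0 Q, face w S v = dimvec MP v].
Proof.
move=> S MP Mw phi.
have hS a (i j : 'I_(plen w).+1) : moves w a i j -> i \in S -> j \in S.
  exact: enclosed_moves.
have hphi : is_hom MP Mw phi by exact: run_map_hom hS.
have emb : is_embedding MP Mw phi.
  by split=> //; apply: coisometry_row_free (run_map_coisometry S K).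
have span := run_map_basis_span S K.
split=> //; [|exact: is_Amod_embedding emb|by move=> v; rewrite (run_mod_dimvec K hS)].
by split=> //; split; [exact: is_submod_hom hphi|exists S].
Qed.
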